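(* Let $q\ge5$ be a prime power. For every integer $k$ with $2q\le k\le 3(q-1)$ there exists a minimal blocking set of size $k$ in $\mathrm{PG}(2,q)$ with the $r_\infty$-property (with respect to some of its points).
   Context: A blocking set of $\mathrm{PG}(2,q)$ is a set of points meeting every line and containing no line; minimal if no proper subset is a blocking set. A line is tangent to a point set $\mathcal{K}$ if it meets $\mathcal{K}$ in exactly one point, secant if in more than one. A blocking set $\mathcal{B}$ has the $r_\infty$-property with respect to $P\in\mathcal{B}$ if exactly one line through $P$ is tangent to $\mathcal{B}$ and all other lines through $P$ are secants. *)

(* Defs.v *)
From HB Require Import structures.
From mathcomp Require Import all_boot all_order all_algebra.

Set Implicit Arguments.
Unset Strict Implicit.
Unset Printing Implicit Defensive.

Import GRing.Theory.
Local Open Scope ring_scope.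

Section FiniteSubspaces.
Import VectorInternalTheory.
Variables (F : finFieldType) (vT : vectType F).

HB.instance Definition _ := [Countable of {vspace vT} by <:].
HB.instance Definition _ := [Finite of {vspace vT} by <:].
End FiniteSubspaces.

(* PG(2,q), for F = GF(q): the points and lines are the 1- and 2-dimensional
   subspaces of F^3, and incidence is inclusion of subspaces. *)
Definition pg_point (F : finFieldType) : finType :=
  {U : {vspace 'rV[F]_3} | \dim U == 1%N}.

Definition pg_line (F : finFieldType) : finType :=
  {U : {vspace 'rV[F]_3} | \dim U == 2%N}.

Definition incident (F : finFieldType) (P : pg_point F) (L : pg_line F) : bool :=
  (val P <= val L)%VS.

Definition points_on (F : finFieldType) (L : pg_line F) : {set pg_point F} :=
  [set P | incident P L].

Definition tangent (F : finFieldType) (K : {set pg_point F}) (L : pg_line F) :=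
  #|points_on L :&: K| == 1%N.

Definition secant (F : finFieldType) (K : {set pg_point F}) (L : pg_line F) :=
  (1 < #|points_on L :&: K|)%N.

Definition blocking_set (F : finFieldType) (B : {set pg_point F}) : bool :=
  [forall L : pg_line F, points_on L :&: B != set0]
  && [forall L : pg_line F, ~~ (points_on L \subset B)].

Definition minimal_blocking_set (F : finFieldType) (B : {set pg_point F}) : bool :=
  minset (@blocking_set F) B.

Definition r_infty_property (F : finFieldType) (B : {set pg_point F})
    (P : pg_point F) : Prop :=
  [/\ P \in B,
      exists! L : pg_line F, incident P L /\ tangent B L
    & forall L : pg_line F, incident P L -> ~~ tangent B L -> secant B L].

(* Main.v *)
(** Identify PG(2,q) with the affine plane over [F] completed by the line at
    infinity.  For [f : F -> F] with [D := f (F \ 0)] consider the set of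
    - the points at infinity of slope [m <> 0],
    - the points [(x, f x)] with [x <> 0],
    - the points [(0, y)] with [y] not in [D].
    Lines of slope [m <> 0] are blocked at infinity, [x = c] is tangent at
    [(c, f c)] for [c <> 0], and [y = d] is tangent at [(0, d)] for [d] not in
    [D].  All other lines through such a point [(0, d)] are secants once the
    complement of [D] has two elements.  So the only condition for minimality is
    that each [m <> 0] admits a [b] in [D] for which [y = m x + b] misses the
    graph of [f] outside [x = 0].  The size is [3q - 2 - #|D|], and [#|D|] takes
    all values from [1] to [q - 2]: for [#|D| = 1] take [f = 0]; otherwise let
    [f] be [1] at [1] and [-1], the identity on a set [C] avoiding
    [0], [1], [-1], [1/2], and [0] elsewhere. *)
Require Import Defs.
From mathcomp Require Import all_boot all_order all_algebra.
From mathcomp Require Import zify ring.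

Set Implicit Arguments.
Unset Strict Implicit.
Unset Printing Implicit Defensive.

Import GRing.Theory.
Local Open Scope ring_scope.

(** * Homogeneous coordinates: affine and infinite points, equations of lines *)

Section Coordinates.
Variable F : finFieldType.

Definition row3 (a b c : F) : 'rV[F]_3 := \row_(i < 3) nth 0 [:: a; b; c] i.

Lemma row3E (v : 'rV[F]_3) :
  v = row3 (v 0 0) (v 0 1) (v 0 (lift ord0 (lift ord0 ord0))).
Proof.
apply/rowP=> -[[|[|[|//]]] Hi]; rewrite mxE /=; congr (v _ _); exact/val_inj.
Qed.

Lemma row3_eq0 a b c : (row3 a b c == 0) = [&& a == 0, b == 0 & c == 0].
Proof.
apply/eqP/and3P => [/rowP E | [/eqP-> /eqP-> /eqP->]].
  have := E 0; have := E 1; have := E (lift ord0 (lift ord0 ord0)).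
  by rewrite !mxE /= => -> -> ->.
by apply/rowP=> -[[|[|[|//]]] Hi]; rewrite !mxE.
Qed.

(** Lines are handled through their equations: [w] is the vector of coefficients. *)
Definition orth (w : 'rV[F]_3) : {vspace 'rV[F]_3} :=
  lker (linfun (mulmxr w^T : 'rV[F]_3 -> 'rV[F]_1)).

Lemma mem_orth v w : (v \in orth w) = (v *m w^T == 0).
Proof. by rewrite memv_ker lfunE. Qed.

Lemma mem_orth3 a b c a' b' c' :
  (row3 a b c \in orth (row3 a' b' c')) = (a * a' + b * b' + c * c' == 0).
Proof.
rewrite mem_orth; apply/eqP/eqP=> [/rowP/(_ 0)|E].
  by rewrite !mxE !big_ord_recl big_ord0 !mxE /= addr0 addrA.
apply/rowP=> i; rewrite !mxE !big_ord_recl big_ord0 !mxE /= addr0 addrA.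
exact: E.
Qed.

Lemma orth0P w : reflect (forall v, v \in orth w) (w == 0).
Proof.
apply: (iffP eqP) => [-> v|E]; first by rewrite mem_orth trmx0 mulmx0.
apply/rowP=> i; have := E (delta_mx 0 i); rewrite mem_orth -rowE => /eqP.
by move/rowP/(_ 0); rewrite !mxE.
Qed.

Lemma dim_orth w : w != 0 -> \dim (orth w) == 2.
Proof.
move=> nz; set g := linfun (mulmxr w^T : 'rV[F]_3 -> 'rV[F]_1).
have /eqP := limg_ker_dim g fullv; rewrite capfv -/(orth w) dimvf dim_matrix.
have: (\dim (limg g) <= 1)%N.
  by rewrite (leq_trans (dimvS (subvf _))) // dimvf dim_matrix.
suff: (0 < \dim (limg g))%N.
  by case: (\dim (limg g)) => [|[|]] //= _ _; rewrite addn1 eqSS.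
(* A zero image would make every vector orthogonal to [w], forcing [w = 0]. *)
rewrite lt0n dimv_eq0; apply: contra nz => /eqP E; apply/orth0P=> v.
by rewrite memv_ker -memv0 -E memv_img ?memvf.
Qed.

Lemma line_orth (L : pg_line F) : exists2 w, w != 0 & val L = orth w.
Proof.
case: L => U dU /=; have dU2 := eqP dU.
(* The columns of [M] form a basis of [U]. With three rows and rank at most 2, [M] has a nonzero
   left kernel vector [w]; then [U] lies in [orth w] and the dimensions agree. *)
pose M : 'M[F]_(3, \dim U) := \matrix_(i, j) (vbasis U)`_j 0 i.
have [w nzw wM] : exists2 w : 'rV[F]_3, w != 0 & w *m M = 0.
  exists (nz_row (kermx M)); last exact/sub_kermxP/nz_row_sub.
  rewrite nz_row_eq0 -mxrank_eq0 mxrank_ker subn_eq0 -ltnNge.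
  by rewrite (leq_ltn_trans (rank_leq_col M)) // dU2.
exists w => //; apply/eqP; rewrite eqEdim (eqP (dim_orth nzw)) dU2 andbT.
rewrite -{1}(span_basis (vbasisP U)); apply/span_subvP=> v vU.
have [j lt_j <-] := nthP 0 vU; rewrite size_tuple in lt_j.
rewrite mem_orth; apply/eqP/rowP=> i; rewrite ord1 !mxE.
have := congr1 (fun A : 'rV_ _ => A 0 (Ordinal lt_j)) wM; rewrite !mxE => E.
by rewrite -[RHS]E; apply: eq_bigr => l _; rewrite !mxE mulrC.
Qed.

Lemma aff_subproof (x y : F) : \dim <[row3 x y 1%R]>%VS == 1%N.
Proof. by rewrite dim_vline row3_eq0 oner_eq0 !andbF. Qed.
Definition aff x y : pg_point F :=
  exist (fun U => \dim U == 1%N) _ (aff_subproof x y).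

Lemma inf_subproof (m : F) : \dim <[row3 1 m 0%R]>%VS == 1%N.
Proof. by rewrite dim_vline row3_eq0 oner_eq0. Qed.
(** The remaining point at infinity, (0 : 1 : 0) on the vertical lines, needs no name: it stays
    outside the blocking set. *)
Definition inf m : pg_point F :=
  exist (fun U => \dim U == 1%N) _ (inf_subproof m).

Lemma vline_subproof (c : F) : \dim (orth (row3 1 0 (- c))) == 2.
Proof. by rewrite dim_orth // row3_eq0 oner_eq0. Qed.
(** In homogeneous coordinates [vline c] is x - c z = 0, [sline m b] is m x - y + b z = 0, and
    [iline] is z = 0. *)
Definition vline c : pg_line F :=
  exist (fun U => \dim U == 2%N) _ (vline_subproof c).

Lemma sline_subproof (m b : F) : \dim (orth (row3 m (-1) b)) == 2.
Proof. by rewrite dim_orth // row3_eq0 oppr_eq0 oner_eq0 andbF. Qed.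
Definition sline m b : pg_line F :=
  exist (fun U => \dim U == 2%N) _ (sline_subproof m b).

Lemma iline_subproof : \dim (orth (row3 0 0 1)) == 2.
Proof. by rewrite dim_orth // row3_eq0 oner_eq0 !andbF. Qed.
Definition iline : pg_line F :=
  exist (fun U => \dim U == 2%N) _ iline_subproof.

Lemma aff_vline x y c : incident (aff x y) (vline c) = (x == c).
Proof.
rewrite /incident /= -memvE mem_orth3 -[RHS]subr_eq0.
by congr (_ == _); ring.
Qed.

Lemma aff_sline x y m b : incident (aff x y) (sline m b) = (y == m * x + b).
Proof.
rewrite /incident /= -memvE mem_orth3 -[RHS]subr_eq0 -[RHS]oppr_eq0.
by congr (_ == _); ring.
Qed.

Lemma aff_iline x y : incident (aff x y) iline = false.
Proof.
by rewrite /incident /= -memvE mem_orth3 !mulr0 !add0r mul1r oner_eq0.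
Qed.

Lemma inf_vline m c : incident (inf m) (vline c) = false.
Proof.
by rewrite /incident /= -memvE mem_orth3 mulr0 mul0r !addr0 mul1r oner_eq0.
Qed.

Lemma inf_sline n m b : incident (inf n) (sline m b) = (n == m).
Proof.
rewrite /incident /= -memvE mem_orth3 -[RHS]subr_eq0 -[RHS]oppr_eq0.
by congr (_ == _); ring.
Qed.

Lemma inf_iline m : incident (inf m) iline.
Proof. by rewrite /incident /= -memvE mem_orth3 !mulr0 mul0r !addr0. Qed.

Variant line_spec : pg_line F -> Prop :=
  | VLine c : line_spec (vline c)
  | SLine m b : line_spec (sline m b)
  | ILine : line_spec iline.

Lemma orthZ k w : k != 0 -> orth (k *: w) = orth w.
Proof.
move=> nz; apply/vspaceP=> v.
by rewrite !mem_orth linearZ /= -scalemxAr scaler_eq0 (negPf nz).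
Qed.

Lemma row3Z k a b c : k *: row3 a b c = row3 (k * a) (k * b) (k * c).
Proof. by apply/rowP=> -[[|[|[|//]]] Hi]; rewrite !mxE. Qed.

(** Scale the equation a x + b y + c z = 0 so that the coefficient of y is -1; if b = 0, make that
    of x equal to 1; if also a = 0, make that of z equal to 1. *)
Lemma lineP L : line_spec L.
Proof.
have [w nzw LE] := line_orth L.
have [a [b [c wE]]] : exists a b c, w = row3 a b c.
  by do 3!eexists; apply: row3E.
rewrite {}wE in nzw LE.
case: (eqVneq b 0) => [b0|nzb]; last first.
  suff -> : L = sline (- a / b) (- c / b) by exact: SLine.
  apply: val_inj; rewrite LE /= -(@orthZ (- b^-1)) ?oppr_eq0 ?invr_eq0 //.
  by rewrite row3Z !mulNr mulVf // ![b^-1 * _]mulrC.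
case: (eqVneq a 0) => [a0|nza]; last first.
  suff -> : L = vline (- c / a) by exact: VLine.
  apply: val_inj; rewrite LE /= -(@orthZ a^-1) ?invr_eq0 //.
  by rewrite row3Z b0 mulr0 mulVf // mulNr opprK mulrC.
suff -> : L = iline by exact: ILine.
move: nzw; rewrite row3_eq0 a0 b0 eqxx /= => nzc.
apply: val_inj; rewrite LE /= -(@orthZ c^-1) ?invr_eq0 //.
by rewrite row3Z a0 b0 mulr0 mulVf.
Qed.

Lemma aff_inj x y x' y' : aff x y = aff x' y' -> x = x' /\ y = y'.
Proof.
move=> E; split; apply/eqP; first by rewrite -(aff_vline x y) E aff_vline.
have := aff_sline x y 0 y'; rewrite E aff_sline !mul0r !add0r eqxx.
by move/esym.
Qed.

Lemma inf_inj : injective inf.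
Proof. by move=> m n E; apply/eqP; rewrite -(inf_sline m n 0) E inf_sline. Qed.

Lemma aff_neq_inf x y m : aff x y != inf m.
Proof. by apply/eqP=> E; have := inf_iline m; rewrite -E aff_iline. Qed.

End Coordinates.

Lemma in_points_on (F : finFieldType) (P : pg_point F) L :
  (P \in points_on L) = incident P L.
Proof. by rewrite inE. Qed.

Lemma in_points_onI (F : finFieldType) (P : pg_point F) L B :
  (P \in points_on L :&: B) = incident P L && (P \in B).
Proof. by rewrite in_setI in_points_on. Qed.

(** * Tangents, secants and minimality for arbitrary point sets *)

Section PointSets.
Variables (F : finFieldType) (B : {set pg_point F}).

Lemma tangentI P L : P \in B -> incident P L ->
  (forall Q, Q \in B -> incident Q L -> Q = P) -> tangent B L.
Proof.
move=> PB PL uP; rewrite /tangent -(cards1 P); apply/eqP/eq_card => Q.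
rewrite !inE; apply/andP/eqP => [[QL QB]|->]; last by [].
exact: uP.
Qed.

Lemma secantI P Q L : P \in B -> Q \in B -> P != Q ->
  incident P L -> incident Q L -> secant B L.
Proof.
move=> PB QB PQ PL QL; rewrite /secant; have := cards2 P Q; rewrite PQ => <-.
by apply: subset_leq_card; apply/subsetP=> R /set2P[]->; rewrite !inE ?PL ?QL.
Qed.

(** A blocking subset of [B] must meet the tangent at each [P], and [P] is the only point of [B]
    there. *)
Lemma minimal_blocking_setI : blocking_set B ->
  (forall P, P \in B -> exists2 L, incident P L & tangent B L) ->
  minimal_blocking_set B.
Proof.
move=> Bb tB; apply/minsetP; split=> // A /andP[/forallP Ab _] AB.
apply/eqP; rewrite eqEsubset AB; apply/subsetP=> P PB.
have [L PL /cards1P[R LB]] := tB P PB.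
have PR : P = R by apply/set1P; rewrite -LB !inE PL.
have [Q] := set0Pn _ (Ab L); rewrite !inE => /andP[QL QA].
have /set1P QR : Q \in [set R] by rewrite -LB !inE QL (subsetP AB).
by rewrite PR -QR.
Qed.

End PointSets.

(** * The blocking set built from a function, and its tangents *)

Section GraphBlockingSet.
Variables (F : finFieldType) (f : F -> F).

Let D := f @: [set~ 0].

Definition graph_set : {set pg_point F} :=
  [set inf m | m in [set~ 0]] :|: [set aff x (f x) | x in [set~ 0]]
    :|: [set aff 0 y | y in ~: D].

Variant graph_set_spec : pg_point F -> Prop :=
  | GInf m of m != 0 : graph_set_spec (inf m)
  | GGraph x of x != 0 : graph_set_spec (aff x (f x))
  | GAxis y of y \notin D : graph_set_spec (aff 0 y).

Lemma graph_setP P : reflect (graph_set_spec P) (P \in graph_set).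
Proof.
apply: (iffP idP) => [|[z Hz|z Hz|z Hz]].
- by case/setUP=> [/setUP[]|] /imsetP[z]; rewrite !inE => Hz ->; constructor.
- by do 2![apply/setUP; left]; apply: imset_f; rewrite !inE.
- by apply/setUP; left; apply/setUP; right; apply: imset_f; rewrite !inE.
- by apply/setUP; right; apply: imset_f; rewrite inE.
Qed.

Lemma inf_graph_set m : (inf m \in graph_set) = (m != 0).
Proof.
apply/graph_setP/idP => [|nz]; last exact: GInf.
move EP: (inf m) => P H; case: P / H EP => [n nz|n _|n _].
- by move/inf_inj->.
- by move/esym/eqP; rewrite (negPf (aff_neq_inf _ _ _)).
- by move/esym/eqP; rewrite (negPf (aff_neq_inf _ _ _)).
Qed.

Lemma aff_graph_set x y :
  (aff x y \in graph_set) = if x == 0 then y \notin D else y == f x.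
Proof.
apply/graph_setP/idP => [|].
  move EP: (aff x y) => P H; case: P / H EP => [n _|n nz|n nD].
  - by move/eqP; rewrite (negPf (aff_neq_inf _ _ _)).
  - by case/aff_inj=> -> ->; rewrite (negPf nz).
  - by case/aff_inj=> -> ->; rewrite eqxx.
case: eqVneq => [->|nz] => [yD|/eqP->]; first exact: GAxis.
exact: GGraph.
Qed.

(** The three families are disjoint, of sizes q - 1, q - 1 and q - |D|. Writing the count as a sum
    avoids subtracting |D|. *)
Lemma card_graph_set : (#|graph_set| + #|D| = 3 * #|F| - 2)%N.
Proof.
have dis1 : [disjoint [set inf m | m in [set~ 0 : F]]
                    & [set aff x (f x) | x in [set~ 0]]].
  rewrite -setI_eq0; apply/eqP/setP=> P; rewrite !inE; apply/negP.
  case/andP=> /imsetP[m _ ->] /imsetP[x _] /esym/eqP.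
  by rewrite (negPf (aff_neq_inf _ _ _)).
have dis2 : [disjoint [set inf m | m in [set~ 0]]
                        :|: [set aff x (f x) | x in [set~ 0]]
                    & [set aff 0 y | y in ~: D]].
  rewrite -setI_eq0; apply/eqP/setP=> P; rewrite !inE; apply/negP.
  case/andP=> PU /imsetP[y _ PE]; move: PU; rewrite {}PE.
  case/orP=> /imsetP[z]; rewrite !inE => nz /eqP.
    by rewrite (negPf (aff_neq_inf _ _ _)).
  by move/eqP/aff_inj => [z0]; rewrite -z0 eqxx in nz.
rewrite /graph_set cardsU (disjoint_setI0 dis2) cards0 subn0.
rewrite cardsU (disjoint_setI0 dis1) cards0 subn0.
rewrite (card_imset _ (@inf_inj F)).
have injG : injective (fun x => aff x (f x)) by move=> x y /aff_inj[].
have injA : injective (aff (0 : F)) by move=> x y /aff_inj[].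
rewrite (card_imset _ injG) (card_imset _ injA).
rewrite cardsC1; have := cardsC D.
have : (0 < #|F|)%N by apply/card_gt0P; exists 0.
(* [set] merges the convertible but distinct forms of [#|F|] for [lia]. *)
set q := #|F|; lia.
Qed.

Hypothesis missD : (2 <= #|~: D|)%N.
Hypothesis miss_graph : forall m, m != 0 ->
  exists2 b, b \in D & forall x, x != 0 -> f x != m * x + b.

Lemma other_notin_D b : exists2 y, y \notin D & y != b.
Proof.
have /card_gt1P[y [z [yD zD yz]]] := missD; rewrite !inE in yD zD.
by case: (eqVneq y b) => [yb|]; [exists z | exists y]; rewrite // -yb eq_sym.
Qed.

Lemma exists_D : exists b, b \in D.
Proof. by exists (f 1); rewrite imset_f // !inE oner_eq0. Qed.

Lemma graph_set_blocking : blocking_set graph_set.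
Proof.
apply/andP; split; apply/forallP=> L.
  apply/set0Pn; case: L / (lineP L) => [c|m b|].
  - case: (eqVneq c 0) => [->|nz].
      have [y yD _] := other_notin_D 0.
      by exists (aff 0 y); rewrite in_points_onI aff_vline aff_graph_set !eqxx.
    exists (aff c (f c)).
    by rewrite in_points_onI aff_vline aff_graph_set (negPf nz) !eqxx.
  - case: (eqVneq m 0) => [->|nz]; last first.
      by exists (inf m); rewrite in_points_onI inf_sline inf_graph_set eqxx.
    (* The horizontal line y = b meets the graph if [b] is in [D], and the chosen part of the axis
       otherwise. *)
    case: (boolP (b \in D)) => [/imsetP[x]|bD].
      rewrite !inE => nz ->; exists (aff x (f x)).
      rewrite in_points_onI aff_sline aff_graph_set (negPf nz).
      by rewrite mul0r add0r !eqxx.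
    exists (aff 0 b).
    by rewrite in_points_onI aff_sline aff_graph_set mul0r add0r !eqxx.
  - by exists (inf 1); rewrite in_points_onI inf_iline inf_graph_set oner_eq0.
apply/subsetPn; case: L / (lineP L) => [c|m b|].
- case: (eqVneq c 0) => [->|nz].
    have [b bD] := exists_D.
    exists (aff 0 b); first by rewrite in_points_on aff_vline.
    by rewrite aff_graph_set eqxx bD.
  exists (aff c (f c + 1)); first by rewrite in_points_on aff_vline.
  rewrite aff_graph_set (negPf nz).
  by rewrite -subr_eq0 addrAC subrr add0r oner_eq0.
- case: (eqVneq m 0) => [->|nz].
    exists (inf 0); first by rewrite in_points_on inf_sline.
    by rewrite inf_graph_set eqxx.
  (* The point of the line at height [y] is off the axis because [y != b], and off the graph because
     [y] is not in [D]. *)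
  have [y yD yb] := other_notin_D b.
  have nzx : (y - b) / m != 0 by rewrite mulf_neq0 ?invr_eq0 ?subr_eq0.
  exists (aff ((y - b) / m) y).
    by rewrite in_points_on aff_sline mulrC divfK // subrK.
  rewrite aff_graph_set (negPf nzx); apply: contra yD => /eqP->.
  by rewrite imset_f // !inE.
- exists (inf 0); first by rewrite in_points_on inf_iline.
  by rewrite inf_graph_set eqxx.
Qed.

Lemma axis_tangent y : y \notin D -> tangent graph_set (sline 0 y).
Proof.
move=> yD; apply: (@tangentI _ _ (aff 0 y)).
- by rewrite aff_graph_set eqxx.
- by rewrite aff_sline mul0r add0r.
move=> Q /graph_setP[m nz|x nz|z zD].
- by rewrite inf_sline (negPf nz).
- rewrite aff_sline mul0r add0r => /eqP E; case/negP: yD.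
  by rewrite -E imset_f // !inE.
- by rewrite aff_sline mul0r add0r => /eqP->.
Qed.

Lemma graph_set_tangent P : P \in graph_set ->
  exists2 L, incident P L & tangent graph_set L.
Proof.
case/graph_setP=> [m nz|x nz|y yD].
- have [b bD mb] := miss_graph nz.
  exists (sline m b); first by rewrite inf_sline.
  apply: (@tangentI _ _ (inf m)); rewrite ?inf_graph_set ?inf_sline //.
  move=> Q /graph_setP[n _|x nzx|y yD].
  + by rewrite inf_sline => /eqP->.
  + by rewrite aff_sline (negPf (mb x nzx)).
  (* The line meets the axis at height [b], which lies in [D], so this point was left out of the
     set. *)
  + by rewrite aff_sline mulr0 add0r => /eqP E; rewrite E bD in yD.
- exists (vline x); first by rewrite aff_vline.
  apply: (@tangentI _ _ (aff x (f x))); rewrite ?aff_vline //.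
    by rewrite aff_graph_set (negPf nz).
  move=> Q /graph_setP[n _|z nzz|y yD].
  + by rewrite inf_vline.
  + by rewrite aff_vline => /eqP->.
  + by rewrite aff_vline eq_sym (negPf nz).
- by exists (sline 0 y); [rewrite aff_sline mul0r add0r | apply: axis_tangent].
Qed.

Lemma graph_set_minimal : minimal_blocking_set graph_set.
Proof.
exact: minimal_blocking_setI graph_set_blocking graph_set_tangent.
Qed.

(** The axis x = 0 contains a second chosen point since the complement of [D] has two elements; a
    line of slope [m != 0] contains [inf m]. *)
Lemma axis_secant y L : y \notin D -> incident (aff 0 y) L ->
  L = sline 0 y \/ secant graph_set L.
Proof.
move=> yD; have yB : aff 0 y \in graph_set by rewrite aff_graph_set eqxx.
case: L / (lineP L) => [c|m b|]; last by rewrite aff_iline.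
  rewrite aff_vline => /eqP<-; right; have [z zD zy] := other_notin_D y.
  apply: (@secantI _ _ (aff 0 y) (aff 0 z)) => //; rewrite ?aff_vline //.
    by rewrite aff_graph_set eqxx.
  by apply/eqP=> /aff_inj[_ E]; rewrite E eqxx in zy.
rewrite aff_sline mulr0 add0r => /eqP<-.
case: (eqVneq m 0) => [->|nz]; [by left | right].
apply: (@secantI _ _ (aff 0 y) (inf m)) => //; last by rewrite inf_sline.
- by rewrite inf_graph_set.
- exact: aff_neq_inf.
- by rewrite aff_sline mulr0 add0r.
Qed.

Lemma graph_set_r_infty : exists P, r_infty_property graph_set P.
Proof.
have [y yD _] := other_notin_D 0; exists (aff 0 y); split.
- by rewrite aff_graph_set eqxx.
- exists (sline 0 y); split.
    by split; [rewrite aff_sline mul0r add0r | apply: axis_tangent].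
  move=> L [/(axis_secant yD)[->//|]].
  (* No line is both tangent and secant, which gives uniqueness. *)
  by rewrite /secant /tangent => /[swap] /eqP->.
- move=> L /(axis_secant yD)[->|//].
  by rewrite (axis_tangent yD).
Qed.

End GraphBlockingSet.

(** * Functions with a prescribed number of values on the nonzero elements *)

Section Functions.
Variable F : finFieldType.

Lemma exists_graph_fun (s : nat) : (0 < s)%N -> (s + 2 <= #|F|)%N ->
  exists f : F -> F, #|f @: [set~ 0]| = s /\
    forall m, m != 0 ->
      exists2 b, b \in f @: [set~ 0] & forall x, x != 0 -> f x != m * x + b.
Proof.
(* From here on the third case calls [s] the required number of values minus 2: besides the elements
   of [C], the values 0 and 1 are taken. *)
case: s => [//|[_ _|s _ les]].
  exists (fun=> 0).
  have im0 : (fun=> 0) @: [set~ (0 : F)] = [set (0 : F)].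
    apply/setP=> y; rewrite inE; apply/imsetP/eqP => [[]//|->].
    by exists 1; rewrite // !inE oner_eq0.
  rewrite im0 cards1; split=> // m nz; exists 0; rewrite ?inE // => x nzx.
  by rewrite addr0 eq_sym mulf_neq0.
(* In characteristic 2, [2^-1 = 0] and [x * 2 = 1] has no solution. *)
pose E : {set F} := [set 0; 1; -1; 2^-1].
have cE : (#|E| <= 4)%N.
  rewrite /E -!setUA; do 3![rewrite cardsU1]; rewrite cards1.
  by do 3![case: (_ \notin _)].
have /card_geqP[t [ut st tC]] : (s <= #|~: E|)%N.
  by move: les (cardsC E); set q := #|F|; lia.
pose C := [set x in t].
have cC : #|C| = s by rewrite cardsE (card_uniqP ut).
have CE x : x \in C -> [/\ x != 0, x != 1, x != -1 & x * 2 != 1].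
  rewrite inE => /tC; rewrite !inE !negb_or => /andP[/andP[/andP[-> -> ->]] x2].
  split=> //; apply: contra x2 => /eqP x2.
  have nz2 : 2 != 0 :> F.
    by apply: contra_eq_neq x2 => ->; rewrite mulr0 eq_sym oner_eq0.
  by rewrite -[x](mulfK nz2) x2 mul1r.
pose f x : F := if x \in C then x else if (x == 1) || (x == -1) then 1 else 0.
have fC x : x \in C -> f x = x by rewrite /f => ->.
have C1 : 1 \notin C by apply/negP=> /CE[_]; rewrite eqxx.
have C0 : 0 \notin C by apply/negP=> /CE[]; rewrite eqxx.
have f1 : f 1 = 1 by rewrite /f (negPf C1) eqxx.
(* The witness [z] makes 0 a value of [f] on the nonzero elements. It exists since at most s + 3
   elements are excluded and q is at least s + 4. *)
have [z] : exists z, z \in ~: (0 |: (1 |: (-1 |: C)) : {set F}).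
  apply/card_gt0P; move: les (cardsC (0 |: (1 |: (-1 |: C)) : {set F})).
  rewrite !cardsU1 cC; set q := #|F|.
  by do 3![case: (_ \notin _)]; lia.
rewrite in_setC !in_setU1 !negb_or => /and4P[nzz z1 zN1 zC].
have fz : f z = 0 by rewrite /f (negPf zC) (negPf z1) (negPf zN1).
have im : f @: [set~ 0] = 0 |: (1 |: C).
  apply/setP=> y; rewrite !in_setU1; apply/imsetP/or3P.
    case=> x _ ->; rewrite /f; case: ifP => xC; first by constructor 3.
    by case: ifP; [constructor 2 | constructor 1].
  case=> [/eqP->|/eqP->|yC]; [exists z | exists 1 | exists y] => //.
  - by rewrite !inE.
  - by rewrite !inE oner_eq0.
  - by rewrite !inE; case/CE: yC.
  - by rewrite fC.
exists f; split.
  by rewrite im !cardsU1 in_setU1 negb_or C0 C1 cC eq_sym oner_eq0.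
move=> m nz; rewrite im.
(* For [m] other than 1 and -1 take b = 0: f x = m x with x nonzero would give m = 1 on [C], m = 1
   or m = -1 at 1 and -1, and m x = 0 elsewhere. *)
case: (boolP ((m == 1) || (m == -1))) => [m1|]; last first.
  rewrite negb_or => /andP[m1 mN1]; exists 0; first by rewrite !in_setU1 eqxx.
  move=> x nzx; rewrite addr0 /f; case: ifP => _.
    by rewrite eq_sym -subr_eq0 -{2}[x]mul1r -mulrBl mulf_neq0 // subr_eq0.
  case: ifP => [/orP[]/eqP->|_].
  - by rewrite mulr1 eq_sym.
  - by rewrite mulrN1 eq_sym eqr_oppLR.
  - by rewrite eq_sym mulf_neq0.
(* For m = 1 or m = -1 take b = 1. On [C], x = x + 1 is absurd and x = -x + 1 means 2 x = 1, which
   [E] rules out; at 1 and -1, 1 = m x + 1 forces x = 0; elsewhere, 0 = m x + 1 forces x to be 1 or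
   -1. *)
exists 1; first by rewrite !in_setU1 eqxx orbT.
move=> x nzx; rewrite /f; case: ifP => [/CE[_ _ _ x2]|_].
  case/orP: m1 => /eqP->.
    by rewrite mul1r -subr_eq0 opprD addNKr oppr_eq0 oner_eq0.
  apply: contra x2 => /eqP Ex; apply/eqP.
  by rewrite mulr2n mulrDr mulr1 {1}Ex; ring.
case: ifP => [_|/negbT].
  by rewrite -subr_eq0 opprD addrC addrNK oppr_eq0 mulf_neq0.
rewrite negb_or => /andP[x1 xN1]; rewrite eq_sym addr_eq0.
case/orP: m1 => /eqP->; first by rewrite mul1r.
by rewrite mulN1r eqr_opp.
Qed.

End Functions.

(* The range of sizes *)
Local Close Scope ring_scope.

(* The order q of the finite field F is automatically a prime power. *)
Theorem theorem3p12 (F : finFieldType) (q : nat) (hF : #|F| = q) (hq : 5 <= q)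
    (k : nat) (hk : 2 * q <= k <= 3 * (q - 1)) :
  exists B : {set pg_point F},
    [/\ minimal_blocking_set B, #|B| = k
      & exists P : pg_point F, r_infty_property B P].
Proof.
(* The number of values is dictated by [card_graph_set]: k <= 3 (q - 1) makes it at least 1, and 2 q
   <= k makes it at most q - 2, which also leaves two elements outside the image. *)
have [f [fs fm]] := @exists_graph_fun F (3 * q - 2 - k) ltac:(lia) ltac:(lia).
have missf : 2 <= #|~: (f @: [set~ 0%R])|.
  by have := cardsC (f @: [set~ 0%R]); rewrite fs hF; lia.
exists (graph_set f); split.
- exact: graph_set_minimal.
- by have := card_graph_set f; rewrite fs hF; lia.
- exact: graph_set_r_infty.
Qed.
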